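(* Let $n\ge 1$ be an integer, $p,q\in[1,\infty)$ and $\lambda,\sigma,\alpha,\beta\in(0,\infty)$. Assume that $$\left(p>1\text{ and }0<\alpha<\tfrac{n+2}{2p}\right)\ \text{ or }\ \left(p=1\text{ and }0<\alpha\le\tfrac{n+2}{2p}\right),$$ $$\left(q>1\text{ and }0<\beta<\tfrac{n+2}{2q}\right)\ \text{ or }\ \left(q=1\text{ and }0<\beta\le\tfrac{n+2}{2q}\right),$$ that $(n+2-2p\alpha)q^2\sigma\le(n+2-2q\beta)p^2\lambda$, and that $2p\alpha=n+2$. Suppose $u\in Y^p_\alpha$ and $v\in Y^q_\beta$ are (necessarily nonnegative) solutions of $$0\le(\partial_t-\Delta)^\alpha u\le v^\lambda,\qquad 0\le(\partial_t-\Delta)^\beta v\le u^\sigma\qquad\text{in }\mathbb{R}^n\times\mathbb{R},$$ $$u=v=0\quad\text{in }\mathbb{R}^n\times(-\infty,0).$$ Then the following statements are true. (i) If $\lambda\sigma\ge1$ then $u=v=0$ a.e. in $\mathbb{R}^n\times\mathbb{R}$. (ii) If $\lambda\sigma<1$ then for all $T>0$ $$\|u\|_{L^\infty(\mathbb{R}^n\times(0,T))}\le M_2^{\frac{\lambda}{1-\lambda\sigma}}T^{\gamma_2/\sigma}\quad\text{and}\quad\|v\|_{L^\infty(\mathbb{R}^n\times(0,T))}\le M_1^{\frac{\sigma}{1-\lambda\sigma}}T^{\gamma_1/\lambda},$$ where $$\gamma_1=\frac{(\beta+\alpha\sigma)\lambda}{1-\lambda\sigma},\qquad\gamma_2=\frac{(\alpha+\beta\lambda)\sigma}{1-\lambda\sigma},$$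 $$M_1=\frac{\Gamma(\gamma_1+1)\Gamma(\gamma_2+1)^{1/\sigma}}{\Gamma(\alpha+\gamma_1+1)\Gamma(\beta+\gamma_2+1)^{1/\sigma}},\qquad M_2=\frac{\Gamma(\gamma_2+1)\Gamma(\gamma_1+1)^{1/\lambda}}{\Gamma(\beta+\gamma_2+1)\Gamma(\alpha+\gamma_1+1)^{1/\lambda}},$$ and $\Gamma$ is the Gamma function.
   Context: For $p\ge1$, $X^p:=\bigcap_{T\in\mathbb{R}}L^p(\mathbb{R}^n\times(-\infty,T))$, i.e. the set of measurable $f:\mathbb{R}^n\times\mathbb{R}\to\mathbb{R}$ with $\|f\|_{L^p(\mathbb{R}^n\times(-\infty,T))}<\infty$ for all $T\in\mathbb{R}$ (functions equal a.e. are identified). For $\alpha>0$ the fractional heat kernel is $$\Phi_\alpha(x,t):=\frac{t^{\alpha-1}}{\Gamma(\alpha)}\frac{1}{(4\pi t)^{n/2}}e^{-|x|^2/(4t)}\chi_{(0,\infty)}(t),$$ and $$J_\alpha f(x,t):=\iint_{\mathbb{R}^n\times(-\infty,t)}\Phi_\alpha(x-\xi,t-\tau)f(\xi,\tau)\,d\xi\,d\tau .$$ Set $Y^p_\alpha:=J_\alpha(X^p)$. When ($p>1$ and $0<\alpha<\frac{n+2}{2p}$) or ($p=1$ and $0<\alpha\le\frac{n+2}{2p}$), it is known that $J_\alpha f\in L^p_{\rm loc}(\mathbb{R}^n\times\mathbb{R})$ for $f\in X^p$ and that $J_\alpha:X^p\to Y^p_\alpha$ is one-to-one and onto; the fully fractional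 heat operator $(\partial_t-\Delta)^\alpha:Y^p_\alpha\to X^p$ is defined as the inverse of $J_\alpha:X^p\to Y^p_\alpha$. Likewise $(\partial_t-\Delta)^\beta:Y^q_\beta\to X^q$ is the inverse of $J_\beta:X^q\to Y^q_\beta$. *)

(* Defs.v *)
From HB Require Import structures.
From mathcomp Require Import all_boot all_order all_algebra.
From mathcomp Require Import all_classical all_reals all_analysis.

Set Implicit Arguments.
Unset Strict Implicit.
Unset Printing Implicit Defensive.

Import Order.TTheory GRing.Theory Num.Theory.
Import numFieldNormedType.Exports.

Local Open Scope classical_set_scope.
Local Open Scope ring_scope.

Section lebesgue_Rn.
Context {R : realType}.
Local Notation mR := (measurableTypeR R).
Local Notation leb := (@lebesgue_measure R).

(* The library has a sigma-algebra on n.-tuple R but no Lebesgue measure; it is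
   built here by recursion on n, as the image under cons of the product of the
   one-dimensional measure with the measure in dimension n. *)
Definition tcons n (z : mR * n.-tuple mR) : n.+1.-tuple mR :=
  [tuple of z.1 :: z.2].

Lemma measurable_tcons n : measurable_fun [set: mR * n.-tuple mR] (@tcons n).
Proof. exact: measurable_cons. Qed.

Section step.
Context n (mu : {sigma_finite_measure set (n.-tuple mR) -> \bar R}).

Definition lebesgue_cons : set (n.+1.-tuple mR) -> \bar R :=
  pushforward (leb \x mu)%E (@tcons n).

Let lebesgue_cons0 : lebesgue_cons set0 = 0%E.
Proof. by rewrite /lebesgue_cons /pushforward preimage_set0 measure0. Qed.

Let lebesgue_cons_ge0 A : (0 <= lebesgue_cons A)%E.
Proof. by rewrite /lebesgue_cons /pushforward; exact: measure_ge0. Qed.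

Let lebesgue_cons_sigma_additive : semi_sigma_additive lebesgue_cons.
Proof.
have mpre A : measurable A -> measurable (@tcons n @^-1` A).
  by move=> mA; rewrite -[X in measurable X]setTI; exact: measurable_tcons.
move=> F mF tF mUF; rewrite /lebesgue_cons /pushforward preimage_bigcup.
apply: measure_semi_sigma_additive.
- by move=> k; exact: mpre.
- apply/trivIsetP => /= i j _ _ ij; rewrite -preimage_setI.
  by move/trivIsetP : tF => /(_ _ _ _ _ ij) ->//; rewrite preimage_set0.
- by rewrite -preimage_bigcup; exact: mpre.
Qed.

HB.instance Definition _ := isMeasure.Build _ _ _ lebesgue_cons
  lebesgue_cons0 lebesgue_cons_ge0 lebesgue_cons_sigma_additive.

Lemma lebesgue_cons_sigma_finite : sigma_finite setT lebesgue_cons.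
Proof.
have /sigma_finiteP[F [TF ndF Foo]] :=
  sigma_finiteT (leb : {sigma_finite_measure set mR -> \bar R}).
have /sigma_finiteP[G [TG ndG Goo]] := sigma_finiteT mu.
pose g (x : n.+1.-tuple mR) : mR * n.-tuple mR :=
  (tnth x ord0, [tuple of behead x]).
have mg : measurable_fun setT g.
  apply: measurable_fun_pair; first exact: measurable_tnth.
  exact: measurable_behead.
have gK z : g (tcons z) = z by case: z => a b; congr pair; exact/val_inj.
exists (fun k => g @^-1` (F k `*` G k)).
  rewrite -preimage_bigcup; apply/seteqP; split => // x _ /=.
  have : [set: mR] (g x).1 by [].
  have : [set: n.-tuple mR] (g x).2 by [].
  rewrite TF TG => -[i _ Gi] [j _ Fj]; exists (maxn i j) => //; split.
  - by move: (g x).1 Fj; exact/subsetPset/ndF/leq_maxr.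
  - by move: (g x).2 Gi; exact/subsetPset/ndG/leq_maxl.
move=> k; have [mF Fk] := Foo k; have [mG Gk] := Goo k; split.
  by rewrite -[X in measurable X]setTI; apply: mg => //; exact: measurableX.
rewrite /lebesgue_cons /pushforward (_ : _ @^-1` _ = F k `*` G k); last first.
  by apply/funext => z; exact: (congr1 (F k `*` G k) (gK z)).
by rewrite product_measure1E// lte_mul_pinfty// ge0_fin_numE.
Qed.

HB.instance Definition _ := Measure_isSigmaFinite.Build _ _ _ lebesgue_cons
  lebesgue_cons_sigma_finite.
End step.

Fixpoint lebesgue_Rn n : {sigma_finite_measure set (n.-tuple mR) -> \bar R} :=
  match n with
  | 0 => [the {sigma_finite_measure set (0.-tuple mR) -> \bar R}
            of @dirac _ (0.-tuple mR) [tuple] R]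
  | m.+1 => [the {sigma_finite_measure set (m.+1.-tuple mR) -> \bar R}
            of lebesgue_cons (lebesgue_Rn m)]
  end.

Lemma lebesgue_Rn_box n (A : 'I_n -> set mR) :
  (forall i, measurable (A i)) ->
  (lebesgue_Rn n [set x | forall i, A i (tnth x i)] =
   \prod_(i < n) leb (A i))%E.
Proof.
elim: n A => [|n IH] A mA.
  by rewrite big_ord0 /= /dirac /= indicE mem_set//= => -[].
rewrite big_ord_recl /= /lebesgue_cons /pushforward.
have -> : @tcons n @^-1` [set x | forall i, A i (tnth x i)] =
    A ord0 `*` [set x | forall i, A (lift ord0 i) (tnth x i)].
  apply/seteqP; split => -[a x] /=.
    move=> h; split; first exact: (h ord0).
    by move=> i; have := h (lift ord0 i); rewrite /tcons /= tnthS.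
  move=> [ha hx] i; rewrite /tcons /=.
  by case: (unliftP ord0 i) => [j ->|->] //; rewrite tnthS.
rewrite product_measure1E//; first by rewrite -IH.
rewrite [X in measurable X](_ : _ = \bigcap_(i in [set: 'I_n])
    ((@tnth n mR)^~ i @^-1` A (lift ord0 i))).
  apply: fin_bigcap_measurable => // i _.
  by rewrite -[X in measurable X]setTI; exact: measurable_tnth.
apply/seteqP; split => x /=; first by move=> h i _; exact: h.
by move=> h i; exact: (h i I).
Qed.
End lebesgue_Rn.

Notation spacetime R n :=
  (n.-tuple (measurableTypeR R) * measurableTypeR R)%type.

Section fractional_heat.
Context {R : realType}.

Definition lebesgue_spacetime n : {measure set (spacetime R n) -> \bar R} :=
  [the {measure set (spacetime R n) -> \bar R}
     of (lebesgue_Rn n \x @lebesgue_measure R)%E].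

Definition Gamma (s : R) : R :=
  \int[lebesgue_measure]_(t in `]0, +oo[) (t `^ (s - 1) * expR (- t)).

Definition sqnorm n (x : n.-tuple R) : R := \sum_(i < n) tnth x i ^+ 2.

Definition frac_heat_kernel n (alpha : R) (x : n.-tuple R) (t : R) : R :=
  t `^ (alpha - 1) / Gamma alpha * ((4 * pi * t) `^ (n%:R / 2))^-1 *
  expR (- (sqnorm x / (4 * t))) * \1_(`]0, +oo[) t.

(* The value is extended-real: wherever the integral of the positive or of the
   negative part diverges, it is infinite, hence never equal to a real. *)
Definition J n (alpha : R) (f : spacetime R n -> R) (z : spacetime R n) :
    \bar R :=
  (\int[lebesgue_spacetime n]_(w in [set w : spacetime R n | (w.2 < z.2)%R])
    (frac_heat_kernel alpha [tuple tnth z.1 i - tnth w.1 i | i < n] (z.2 - w.2)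
      * f w)%:E)%E.

(* Elements of function spaces are functions, compared almost everywhere.
   Measurability is Borel measurability: every class of Lebesgue measurable
   functions has a Borel representative. *)
Definition Xspace n (p : R) : set (spacetime R n -> R) :=
  [set f : spacetime R n -> R | measurable_fun setT f /\
    forall T : R, finite_norm (lebesgue_spacetime n) p%:E
      (fun z => f z * \1_[set w : spacetime R n | w.2 < T] z)].

Definition J_preimage n (p alpha : R) (u : spacetime R n -> R) :
    set (spacetime R n -> R) :=
  [set f | Xspace p f /\
    \forall z \ae lebesgue_spacetime n, (u z)%:E = J alpha f z].

Definition Yspace n (p alpha : R) : set (spacetime R n -> R) :=
  [set u | J_preimage p alpha u !=set0].

(* The inverse of J alpha : Xspace p -> Yspace p alpha; the value is a
   representative of the preimage class, and is junk outside Yspace. *)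
Definition frac_heat n (p alpha : R) (u : spacetime R n -> R) :
    spacetime R n -> R :=
  xget (cst 0) (J_preimage p alpha u).

Definition admissible n (p alpha : R) : Prop :=
  (1 < p /\ 0 < alpha < (n%:R + 2) / (2 * p)) \/
  (p = 1 /\ 0 < alpha <= (n%:R + 2) / (2 * p)).

Definition Linfty_norm n (u : spacetime R n -> R) (T : R) : \bar R :=
  ('N[lebesgue_spacetime n]_+oo
    [(fun z => (u z * \1_[set w : spacetime R n | (0 < w.2 < T)%R] z)%:E)])%E.

Section constants.
Variables lambda sigma alpha beta : R.

Definition gamma1 : R :=
  (beta + alpha * sigma) * lambda / (1 - lambda * sigma).

Definition gamma2 : R :=
  (alpha + beta * lambda) * sigma / (1 - lambda * sigma).

Definition M1 : R :=
  (Gamma (gamma1 + 1) * Gamma (gamma2 + 1) `^ (sigma^-1)) /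
  (Gamma (alpha + gamma1 + 1) * Gamma (beta + gamma2 + 1) `^ (sigma^-1)).

Definition M2 : R :=
  (Gamma (gamma2 + 1) * Gamma (gamma1 + 1) `^ (lambda^-1)) /
  (Gamma (beta + gamma2 + 1) * Gamma (alpha + gamma1 + 1) `^ (lambda^-1)).

End constants.
End fractional_heat.

(* Main.v *)
(* In the critical case p = 1 and alpha = (n + 2) / 2, so that the kernel
   Phi_alpha is bounded and u = J_alpha f is bounded for t < T by a multiple of
   the L^1 norm of f. Since Phi_alpha (., t) has integral
   t^(alpha - 1) / Gamma alpha over R^n, a bound of f by a function of time
   alone yields a bound of u by the Riemann-Liouville integral of this
   function, and a bound u <= m w(t) is improved by one turn through the system
   to u <= c m^(lambda sigma) w(t) whenever the weight w reproduces itself. The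
   weight (t + e)^(gamma2 / sigma) does so with the constants of the theorem, by
   Euler's Beta integral; as lambda sigma < 1, the best m is at most the fixed
   point of m |-> c m^(lambda sigma), and e tends to 0. If lambda sigma >= 1,
   the weight exp(L t) with L large halves m, hence u = 0. *)

From HB Require Import structures.
Require Import Defs.
From mathcomp Require Import all_boot all_order all_algebra.
From mathcomp Require Import all_classical all_reals all_analysis.
From mathcomp Require Import measurable_realfun ring lra.

Import Order.TTheory GRing.Theory Num.Theory.
Import numFieldNormedType.Exports.

Local Open Scope classical_set_scope.
Local Open Scope ring_scope.

(** * Changes of variable and the Gamma integral *)

Section one_dimensional.
Set Implicit Arguments.
Unset Strict Implicit.
Context {R : realType}.
Local Notation leb := (@lebesgue_measure R).
Implicit Types (a b c s t x y : R).

Lemma measurable_affine a b :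
  measurable_fun [set: measurableTypeR R]
    (fun x : measurableTypeR R => a * x + b : measurableTypeR R).
Proof. by apply: measurable_funD => //; exact: measurable_funM. Qed.

Lemma affine_preimage_pos a b c d : 0 < a ->
  (fun x => a * x + b) @^-1` `]c, d]%classic = `](c - b) / a, (d - b) / a]%classic.
Proof.
move=> a0; apply/seteqP; split => x /=; rewrite !in_itv/= ltr_pdivrMr// ler_pdivlMr//;
  by rewrite ltrBlDr lerBrDr mulrC.
Qed.

Lemma affine_preimage_neg a b c d : a < 0 ->
  (fun x => a * x + b) @^-1` `]c, d]%classic = `[(d - b) / a, (c - b) / a[%classic.
Proof.
move=> a0; apply/seteqP; split => x /=; rewrite !in_itv/= ltr_ndivlMr// ler_ndivrMr//;
  by rewrite ltrBlDr lerBrDr mulrC andbC.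
Qed.

(* The instance is named because the measurability proof is one of its
   arguments and unification cannot find it. *)
Definition affine_image a b : {measure set (measurableTypeR R) -> \bar R} :=
  measure_function_pushforward__canonical__measure_function_Measure leb
    (measurable_affine a b).

(** By uniqueness of Lebesgue measure it suffices to compare both sides on half-open intervals. For
    negative [a] the preimage is closed on the left instead of the right, which leaves its length
    unchanged. *)
Lemma lebesgue_measure_affine a b (A : set (measurableTypeR R)) :
  a != 0 -> measurable A -> leb A = mscale (NngNum (normr_ge0 a)) (affine_image a b) A.
Proof.
move=> a0 mA; apply: lebesgue_measure_unique => //= _ [[c d]] _ <-.
rewrite /mscale /= /pushforward.
have [an|ap|/eqP] := ltgtP a 0; last by rewrite (negbTE a0).
- rewrite affine_preimage_neg// !lebesgue_measure_itv/= !lte_fin.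
  rewrite ltr_nM2r ?invr_lt0// ltrD2r; case: ifP => _; last by rewrite mule0.
  by rewrite ltr0_norm// -!EFinB -EFinM; congr EFin; field.
- rewrite affine_preimage_pos// !lebesgue_measure_itv/= !lte_fin.
  rewrite ltr_pM2r ?invr_gt0// ltrD2r; case: ifP => _; last by rewrite mule0.
  by rewrite gtr0_norm// -!EFinB -EFinM; congr EFin; field.
Qed.

Lemma ge0_integral_affine a b (f : R -> \bar R) : a != 0 ->
  measurable_fun [set: R] f -> (forall x, 0 <= f x)%E ->
  (\int[leb]_x f x = `|a|%:E * \int[leb]_x f (a * x + b)%R)%E.
Proof.
move=> a0 mf f0.
transitivity (\int[mscale (NngNum (normr_ge0 a)) (affine_image a b)]_x f x)%E.
  by apply: eq_measure_integral => A mA _; exact: lebesgue_measure_affine.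
rewrite ge0_integral_mscale//; congr (_ * _)%E.
by rewrite ge0_integral_pushforward//; exact: measurable_affine.
Qed.

Lemma ge0_integral_reflect t (f : R -> \bar R) :
  measurable_fun [set: R] f -> (forall x, 0 <= f x)%E ->
  (\int[leb]_x f (t - x)%R = \int[leb]_x f x)%E.
Proof.
move=> mf f0; rewrite [RHS](@ge0_integral_affine (-1) t)//.
rewrite normrN1 mul1e; apply: eq_integral => x _; congr f.
by rewrite mulN1r addrC.
Qed.

Lemma ge0_integral_shift t (f : R -> \bar R) :
  measurable_fun [set: R] f -> (forall x, 0 <= f x)%E ->
  (\int[leb]_x f (x + t)%R = \int[leb]_x f x)%E.
Proof.
move=> mf f0; rewrite [RHS](@ge0_integral_affine 1 t)//.
by rewrite normr1 mul1e; apply: eq_integral => x _; rewrite mul1r.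
Qed.

Lemma ge0_integral_scale c (f : R -> \bar R) : 0 < c ->
  measurable_fun [set: R] f -> (forall x, 0 <= f x)%E ->
  (\int[leb]_x f (c * x)%R = c^-1%:E * \int[leb]_x f x)%E.
Proof.
move=> c0 mf f0; rewrite [X in (_ * X)%E](@ge0_integral_affine c 0) ?gt_eqF//.
rewrite gtr0_norm// muleA -EFinM mulVf ?gt_eqF// mul1e.
by apply: eq_integral => x _; rewrite addr0.
Qed.

(* Unlike [x `^ a], which is 1 for [x < 0] and for [x = a = 0], this vanishes
   for all [x <= 0]. *)
Definition ppow a x : R := \1_(`]0, +oo[) x * x `^ a.

Lemma ppow_pos a x : 0 < x -> ppow a x = x `^ a.
Proof. by move=> x0; rewrite /ppow indicE mem_set ?mul1r//= in_itv/= x0. Qed.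

Lemma ppow_npos a x : x <= 0 -> ppow a x = 0.
Proof.
move=> x0; rewrite /ppow indicE memNset ?mul0r//= in_itv/= andbT.
by apply/negP; rewrite -leNgt.
Qed.

Lemma ppow_ge0 a x : 0 <= ppow a x.
Proof. by rewrite /ppow mulr_ge0 ?powR_ge0. Qed.

Lemma measurable_ppow a : measurable_fun [set: R] (ppow a).
Proof. by apply: measurable_funM => //; exact: measurable_powR. Qed.

Lemma ppow_scale a c x : 0 < c -> ppow a (c * x) = c `^ a * ppow a x.
Proof.
move=> c0; have [x0|x0] := leP x 0.
  by rewrite !ppow_npos ?mulr0// pmulr_rle0.
by rewrite !ppow_pos ?mulr_gt0// powRM// ltW.
Qed.

Lemma ppow_powR a s x : 0 < s -> ppow a x `^ s = ppow (a * s) x.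
Proof.
move=> s0; have [x0|x0] := leP x 0.
  by rewrite !ppow_npos// powR0// gt_eqF.
by rewrite !ppow_pos// powRrM.
Qed.

(* [Gamma] itself is 0 where the integral diverges. *)
Definition gamma_integral a : \bar R := (\int[leb]_x (ppow (a - 1) x * expR (- x))%:E)%E.

Lemma measurable_ppow_exp a c : measurable_fun [set: R] (fun x => ppow a x * expR (- (c * x))).
Proof.
apply: measurable_funM; first exact: measurable_ppow.
by apply: measurableT_comp => //; apply: measurableT_comp.
Qed.

Lemma GammaE a : Gamma a = fine (gamma_integral a).
Proof.
rewrite /Gamma /Rintegral /gamma_integral; congr fine.
rewrite integral_mkcond; apply: eq_integral => x _ /=.
rewrite patchE /=; case: ifPn => [|x0].
  by rewrite inE/= in_itv/= andbT => x0; rewrite ppow_pos.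
rewrite ppow_npos ?mul0r// leNgt; apply: contra x0 => x0.
by rewrite inE/= in_itv/= x0.
Qed.

Lemma gamma_integral_ge0 a : (0 <= gamma_integral a)%E.
Proof. by apply: integral_ge0 => x _; rewrite lee_fin mulr_ge0 ?ppow_ge0 ?expR_ge0. Qed.

(** A vanishing integral would force the integrand to vanish almost everywhere, but it is positive
    on ]0, 1[, which has measure 1. *)
Lemma gamma_integral_gt0 a : (0 < gamma_integral a)%E.
Proof.
rewrite lt0e gamma_integral_ge0 andbT; apply/negP => /eqP g0.
have mf : measurable_fun [set: R] (fun x => (ppow (a - 1) x * expR (- x))%:E).
  apply/measurable_EFinP; apply: eq_measurable_fun (measurable_ppow_exp (a - 1) 1).
  by move=> x _; rewrite mul1r.
have /(ae_eq_integral_abs leb measurableT mf)[N [mN N0 subN]] :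
    (\int[leb]_x `|(ppow (a - 1) x * expR (- x))%:E| = 0)%E.
  rewrite -[RHS]g0; apply: eq_integral => x _.
  by rewrite gee0_abs// lee_fin mulr_ge0 ?ppow_ge0 ?expR_ge0.
have : (leb `]0%R, 1%R[ <= leb N)%E.
  apply: le_measure; rewrite ?inE//.
  apply: subset_trans subN => x /=; rewrite in_itv/= => /andP[x0 _] /(_ I) [].
  by apply/eqP; rewrite mulf_neq0 ?gt_eqF ?expR_gt0// ppow_pos// powR_gt0.
by rewrite N0 lebesgue_measure_itv/= lte_fin ltr01 oppr0 adde0 lee_fin ler10.
Qed.

(** The singularity at 0 is approached by compact intervals; on each the primitive x^a / a bounds
    the integral by 1/a, and monotone convergence passes this bound on. *)
Lemma integral_powR_unit a : 0 < a ->
  (\int[leb]_(x in `]0%R, 1%R]) (x `^ (a - 1))%:E < +oo)%E.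
Proof.
(* The shift by two keeps the left end strictly below 1, as the fundamental theorem of calculus
   requires. *)
move=> a0; pose F k := `[(k.+2%:R)^-1, 1 : R]%classic.
have -> : `]0%R, 1%R]%classic = \bigcup_k F k.
  apply/seteqP; split => [x /=|x [k _]]; rewrite /F/= !in_itv/=.
    move=> /andP[x0 x1]; have [k kx] : exists k : nat, (k.+1%:R)^-1 < x.
      by exists (Num.truncn x^-1); rewrite invf_plt ?posrE// truncnS_gt.
    exists k => //=; rewrite in_itv/= x1 andbT ltW// (le_lt_trans _ kx)//.
    by rewrite lef_pV2 ?posrE// ler_nat.
  by move=> /andP[kx ->]; rewrite andbT (lt_le_trans _ kx).
have mF k : measurable_fun (F k) (fun x => (x `^ (a - 1))%:E).
  by apply/measurable_EFinP; apply: measurable_funTS; exact: measurable_powR.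
have ndF : nondecreasing_seq F.
  apply/nondecreasing_seqP => k; apply/subsetPset => x; rewrite /F/= !in_itv/=.
  by move=> /andP[kx ->]; rewrite andbT (le_trans _ kx)// lef_pV2 ?posrE// ler_nat.
have mmF k : measurable (F k : set (measurableTypeR R)) by exact: measurable_itv.
have F0 k x : F k x -> (0 <= (x `^ (a - 1))%:E)%E by rewrite lee_fin powR_ge0.
apply: (@le_lt_trans _ _ (a^-1)%:E); last by rewrite ltry.
have := @ge0_nondecreasing_set_cvg_integral _ (measurableTypeR R) R F _ leb ndF mmF mF F0.
move=> /(@cvg_lim _ _ _) <-//.
apply: lime_le.
  apply: ereal_nondecreasing_is_cvgn.
  exact: (@ge0_nondecreasing_set_nondecreasing_integral _ (measurableTypeR R)).
apply: nearW => k.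
have k0 : 0 < (k.+2%:R : R)^-1 by rewrite invr_gt0.
have k1 : (k.+2%:R : R)^-1 < 1 by rewrite invf_lt1// ltr1n.
have cp r x : 0 < x -> {for x, continuous (@powR R ^~ r)}.
  move=> x0; apply: differentiable_continuous; apply/derivable1_diffP.
  by apply: derivable_powR; rewrite in_itv/= x0.
rewrite (@continuous_FTC2 _ _ (fun x => x `^ a / a))//.
- by rewrite powR1 -EFinB lee_fin -mulrBl ler_piMl ?invr_ge0 ?(ltW a0)// gerBl powR_ge0.
- apply: continuous_in_subspaceT => x; rewrite inE/= in_itv/= => /andP[kx _].
  by apply: cp; apply: lt_le_trans kx.
- split.
  + move=> x; rewrite in_itv/= => /andP[kx _].
    by apply: derivableM => //; apply: derivable_powR; rewrite in_itv/= (lt_trans k0 kx).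
  + by apply: cvg_at_right_filter; apply: cvgM; [exact: (cp a _ k0)|exact: cvg_cst].
  + by apply: cvg_at_left_filter; apply: cvgM; [exact: (cp a _ ltr01)|exact: cvg_cst].
- move=> x; rewrite in_itv/= => /andP[kx _].
  have x0 := lt_trans k0 kx.
  rewrite derive1Mr; last by apply: derivable_powR; rewrite in_itv/= x0.
  by rewrite powR_derive1 ?in_itv/= ?x0// mulrAC divff ?mul1r// gt_eqF.
Qed.

(** Writing ln x = ln (1/k) + ln (k x) and bounding the last term by k x gives a linear bound of ln
    x; the slope k = c / (|a| + 1) satisfies |a| k <= c. *)
Lemma powR_le_exp a c : 0 < c ->
  exists2 K, 0 < K & forall x, 1 <= x -> x `^ a <= K * expR (c * x).
Proof.
move=> c0; pose k := c / (`|a| + 1).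
have k0 : 0 < k by rewrite divr_gt0// ltr_wpDl.
exists (expR (`|a| * `|ln k^-1|)); first exact: expR_gt0.
move=> x x1; have x0 : 0 < x by apply: lt_le_trans x1.
rewrite /powR gt_eqF// -expRD ler_expR.
have lnx0 : 0 <= ln x by rewrite ln_ge0.
have lnx : ln x <= `|ln k^-1| + k * x.
  have -> : ln x = ln k^-1 + ln (k * x).
    by rewrite -lnM ?posrE ?mulr_gt0 ?invr_gt0// mulKf// gt_eqF.
  rewrite lerD ?ler_norm// -[X in ln X](subrKC 1).
  have kx0 : 0 < k * x by rewrite mulr_gt0.
  by apply: le_trans (le_ln1Dx _) _; rewrite ?gerBl// ltrBrDr addNr.
apply: le_trans (ler_wpM2r lnx0 (ler_norm a)) _.
apply: le_trans (ler_wpM2l (normr_ge0 a) lnx) _.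
rewrite mulrDr lerD2l mulrA ler_wpM2r ?(ltW x0)//.
rewrite /k mulrCA ger_pMr// ler_pdivrMr ?ltr_wpDl// mul1r.
by rewrite lerDl.
Qed.

(** The integrand is at most x^(a - 1) on ]0, 1], and beyond 1 at most K exp(- x / 2), a multiple of
    an exponential density. *)
Lemma gamma_integral_fin a : 0 < a -> (gamma_integral a < +oo)%E.
Proof.
move=> a0; have half0 : 0 < 2^-1 :> R by rewrite invr_gt0.
have [K K0 leK] := powR_le_exp (a - 1) half0.
(* The factor 2 cancels the rate 1/2 in front of the exponential density. *)
apply: (@le_lt_trans _ _ (\int[leb]_x ((\1_(`]0%R, 1%R]) x * (x `^ (a - 1)))%:E +
    (2 * K * exponential_pdf 2^-1 x)%:E))%E).
  apply: ge0_le_integral => //.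
  - by move=> x _; rewrite lee_fin mulr_ge0 ?ppow_ge0 ?expR_ge0.
  - apply/measurable_EFinP; apply: eq_measurable_fun (measurable_ppow_exp (a - 1) 1).
    by move=> x _; rewrite mul1r.
  - apply: emeasurable_funD; apply/measurable_EFinP.
      by apply: measurable_funM => //; exact: measurable_powR.
    by apply: measurable_funM => //; exact: measurable_exponential_pdf.
  move=> x _; rewrite -EFinD lee_fin.
  have e0 : 0 <= 2 * K * exponential_pdf 2^-1 x.
    by rewrite mulr_ge0 ?exponential_pdf_ge0 ?(ltW half0)// mulr_ge0// ltW.
  have [x0|x0] := leP x 0.
    by rewrite ppow_npos// mul0r addr_ge0// mulr_ge0// powR_ge0.
  rewrite ppow_pos// indicE.
  have [x1|x1] := leP x 1.
    rewrite mem_set/= ?mul1r; last by rewrite in_itv/= x0.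
    rewrite ler_wpDr// ler_piMr ?powR_ge0//.
    by rewrite -expR0 ler_expR oppr_le0 ltW.
  rewrite memNset/= ?mul0r ?add0r; last by rewrite in_itv/= x0/= leNgt x1.
  rewrite exponential_pdfE ?(ltW x0)//.
  apply: le_trans (ler_wpM2r (expR_ge0 _) (leK _ (ltW x1))) _.
  rewrite -[leLHS]mulrA -expRD [leRHS](_ : _ = K * expR (- 2^-1 * x)); last by field.
  by rewrite ler_wpM2l ?(ltW K0)// ler_expR; lra.
have mU : measurable_fun [set: R] (fun x => (\1_(`]0%R, 1%R]) x * (x `^ (a - 1)))%:E).
  by apply/measurable_EFinP; apply: measurable_funM => //; exact: measurable_powR.
have mE : measurable_fun [set: R] (EFin \o exponential_pdf (2^-1 : R)).
  by apply/measurable_EFinP; exact: measurable_exponential_pdf.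
have E0 x : (0 <= (exponential_pdf 2^-1 x)%:E)%E by rewrite lee_fin exponential_pdf_ge0// ltW.
under eq_integral do rewrite (EFinM (2 * K)).
rewrite ge0_integralD//; last 3 first.
- by move=> x _; rewrite lee_fin mulr_ge0// powR_ge0.
- by move=> x _; rewrite mule_ge0// lee_fin mulr_ge0// ltW.
- exact: measurable_funeM.
rewrite ge0_integralZl//; last by rewrite lee_fin mulr_ge0// ltW.
rewrite integral_exponential_pdf// mule1 lte_add_pinfty ?ltry//.
have := integral_powR_unit a0; rewrite [X in (X < _)%E -> _]integral_mkcond; congr (_ < _)%E.
apply: eq_integral => x _; rewrite patchE indicE; case: ifPn => _; first by rewrite mul1r.
by rewrite mul0r.
Qed.

Lemma Gamma_gt0 a : 0 < a -> 0 < Gamma a.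
Proof.
by move=> a0; rewrite GammaE fine_gt0// gamma_integral_gt0 gamma_integral_fin.
Qed.

Lemma gamma_integralE a : 0 < a -> gamma_integral a = (Gamma a)%:E.
Proof.
by move=> a0; rewrite GammaE fineK// ge0_fin_numE ?gamma_integral_fin ?gamma_integral_ge0.
Qed.

End one_dimensional.
(** * Riemann-Liouville potentials of powers and exponentials *)

Section riemann_liouville.
Set Implicit Arguments.
Unset Strict Implicit.
Context {R : realType}.
Local Notation leb := (@lebesgue_measure R).
Implicit Types (a b c s t x y : R).

Lemma measurable_ppow_comp d (T : measurableType d) a (f : T -> R) :
  measurable_fun [set: T] f -> measurable_fun [set: T] (fun z => ppow a (f z)).
Proof. by move=> mf; apply: measurableT_comp mf; exact: measurable_ppow. Qed.

(** At s = 1 this is Euler's Beta integral: [ppow] confines y to ]0, s[, so the integral can be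
    taken over the whole line. *)
Definition beta_conv a b s : \bar R :=
  (\int[leb]_y (ppow (a - 1) (s - y) * ppow (b - 1) y)%:E)%E.

Lemma measurable_beta_integrand a b s :
  measurable_fun [set: R] (fun y => (ppow a (s - y) * ppow b y)%:E).
Proof.
apply/measurable_EFinP; apply: measurable_funM; last exact: measurable_ppow.
by apply: measurable_ppow_comp; exact: measurable_funB.
Qed.

Lemma beta_integrand_ge0 a b s y : (0 <= (ppow a (s - y) * ppow b y)%:E)%E.
Proof. by rewrite lee_fin mulr_ge0 ?ppow_ge0. Qed.

Lemma measurable_gamma_integrand a :
  measurable_fun [set: R] (fun y => (ppow a y * expR (- y))%:E).
Proof.
apply/measurable_EFinP; apply: eq_measurable_fun (measurable_ppow_exp a 1).
by move=> y _; rewrite mul1r.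
Qed.

Lemma gamma_integrand_ge0 a y : (0 <= (ppow a y * expR (- y))%:E)%E.
Proof. by rewrite lee_fin mulr_ge0 ?ppow_ge0 ?expR_ge0. Qed.

(** Homogeneity, by the substitution of s y for y; for s <= 0 one of the two factors always
    vanishes. *)
Lemma beta_conv_scale a b s :
  beta_conv a b s = ((ppow (a + b - 1) s)%:E * beta_conv a b 1)%E.
Proof.
have [s0|s0] := leP s 0.
  rewrite ppow_npos// mul0e; apply: integral0_eq => y _.
  have [y0|y0] := leP y 0; first by rewrite (ppow_npos _ y0) mulr0.
  by rewrite ppow_npos ?mul0r// subr_le0 (le_trans s0)// ltW.
have := ge0_integral_scale s0 (measurable_beta_integrand (a - 1) (b - 1) s)
  (beta_integrand_ge0 (a - 1) (b - 1) s).
under eq_integral => y _.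
  have -> : s - s * y = s * (1 - y) by ring.
  rewrite !ppow_scale// mulrACA EFinM; over.
rewrite ge0_integralZl; last 4 first.
- exact: measurableT.
- exact: measurable_beta_integrand.
- by move=> y _; exact: beta_integrand_ge0.
- by rewrite lee_fin mulr_ge0 ?powR_ge0.
rewrite -/(beta_conv a b 1) -/(beta_conv a b s) => sE.
have -> : beta_conv a b s = (s%:E * (s^-1%:E * beta_conv a b s))%E.
  by rewrite muleA -EFinM divff ?gt_eqF// mul1e.
rewrite -sE muleA -EFinM (ppow_pos _ s0); congr ((_)%:E * _)%E.
rewrite -powRD; last by rewrite (gt_eqF s0) implybT.
rewrite -[X in X * _](powRr1 (ltW s0)) -powRD; last by rewrite (gt_eqF s0) implybT.
by congr powR; ring.
Qed.

(* Euler's argument: the substitution [x = s - y] in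
   [Gamma a * Gamma b], followed by Tonelli's theorem. *)
Lemma beta_conv1 a b : 0 < a -> 0 < b ->
  beta_conv a b 1 = (Gamma a * Gamma b / Gamma (a + b))%:E.
Proof.
move=> a0 b0; have ab0 : 0 < a + b by rewrite addr_gt0.
pose F (z : measurableTypeR R * measurableTypeR R) : \bar R :=
  (expR (- z.1) * (ppow (a - 1) (z.1 - z.2) * ppow (b - 1) z.2))%:E.
have mF : measurable_fun setT F.
  apply/measurable_EFinP; apply: measurable_funM.
    by apply: measurableT_comp => //; exact: measurableT_comp.
  apply: measurable_funM; apply: measurable_ppow_comp => //.
  exact: measurable_funB.
have F0 z : (0 <= F z)%E by rewrite /F lee_fin mulr_ge0 ?expR_ge0// mulr_ge0 ?ppow_ge0.
(* Integrating over y first leaves exp(- x) times a Beta convolution, which scales to a Gamma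
   integrand; in the other order the shift by y splits the exponential into a product. *)
have E1 : (\int[leb]_x \int[leb]_y F (x, y) = (Gamma (a + b))%:E * beta_conv a b 1)%E.
  rewrite -gamma_integralE// /gamma_integral -ge0_integralZr//; last 3 first.
  - exact: measurable_gamma_integrand.
  - by move=> y _; exact: gamma_integrand_ge0.
  - by apply: integral_ge0 => y _; exact: beta_integrand_ge0.
  apply: eq_integral => s _; rewrite /F/=.
  under eq_integral do rewrite EFinM.
  rewrite ge0_integralZl; last 4 first.
  - exact: measurableT.
  - exact: measurable_beta_integrand.
  - by move=> y _; exact: beta_integrand_ge0.
  - by rewrite lee_fin expR_ge0.
  by rewrite -/(beta_conv a b s) beta_conv_scale muleA -EFinM [(expR _ * _)%R]mulrC.
have E2 : (\int[leb]_y \int[leb]_x F (x, y) = (Gamma a * Gamma b)%:E)%E.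
  rewrite EFinM -!gamma_integralE// muleC.
  rewrite [X in (X * _)%E]/gamma_integral -ge0_integralZr//; last 3 first.
  - exact: measurable_gamma_integrand.
  - by move=> y _; exact: gamma_integrand_ge0.
  - exact: gamma_integral_ge0.
  apply: eq_integral => y _; rewrite /F/= /gamma_integral.
  rewrite -(ge0_integral_shift (- y) (measurable_gamma_integrand _) (gamma_integrand_ge0 _)).
  rewrite -ge0_integralZl//; last 3 first.
  - have my : measurable_fun [set: R] (fun x => x - y) by exact: measurable_funB.
    exact: (measurableT_comp (measurable_gamma_integrand (a - 1)) my).
  - by move=> x _; exact: gamma_integrand_ge0.
  - exact: gamma_integrand_ge0.
  apply: eq_integral => x _; rewrite -EFinM; congr EFin.
  have -> : expR (- x) = expR (- y) * expR (- (x - y)).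
    by rewrite -expRD; congr expR; ring.
  by ring.
have G := Gamma_gt0 ab0.
have := etrans (etrans (esym E1) (fubini_tonelli (m1 := leb) (m2 := leb) F mF F0)) E2.
move/(congr1 (fun x : \bar R => (Gamma (a + b))^-1%:E * x)%E).
by rewrite muleA -!EFinM mulVf ?gt_eqF// mul1e => ->; rewrite mulrC.
Qed.

(** The Riemann-Liouville integral of order a with initial time minus infinity; [ppow] cuts it off
    at tau = t. *)
Definition time_potential a (phi : R -> R) t : \bar R :=
  (\int[leb]_tau (ppow (a - 1) (t - tau) / Gamma a * phi tau)%:E)%E.

(** After the shift by e this is a Beta convolution with parameters a and s + 1, evaluated at t +
    e. *)
Lemma time_potential_ppow a s e t : 0 < a -> 0 <= s ->
  time_potential a (fun tau => ppow s (tau + e)) t =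
    (Gamma (s + 1) / Gamma (a + s + 1) * ppow (a + s) (t + e))%:E.
Proof.
move=> a0 s0; have s1 : 0 < s + 1 by rewrite ltr_wpDl.
have Ga := Gamma_gt0 a0; have Gas : 0 < Gamma (a + s + 1).
  by rewrite Gamma_gt0// -addrA addr_gt0.
transitivity ((Gamma a)^-1%:E * beta_conv a (s + 1) (t + e))%E; last first.
  rewrite beta_conv_scale beta_conv1// -!EFinM; congr EFin.
  rewrite addrA addrK; move: Ga Gas.
  move: (Gamma a) (Gamma (s + 1)) (Gamma (a + s + 1)) => x y r x0 r0.
  by field; rewrite !gt_eqF.
rewrite /beta_conv -(ge0_integral_shift e (measurable_beta_integrand _ _ _)
  (beta_integrand_ge0 _ _ _)) -ge0_integralZl//; last 3 first.
- have me : measurable_fun [set: R] (fun y => y + e) by exact: measurable_funD.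
  exact: (measurableT_comp (measurable_beta_integrand (a - 1) (s + 1 - 1) (t + e)) me).
- by move=> x _; exact: beta_integrand_ge0.
- by rewrite lee_fin invr_ge0 ltW.
apply: eq_integral => tau _; rewrite -EFinM addrK; congr EFin.
have -> : t + e - (tau + e) = t - tau by ring.
by ring.
Qed.

(** Exponentials are eigenfunctions: with x = t - tau the factor exp(c t) comes out and a rescaled
    Gamma integral remains. *)
Lemma time_potential_exp a c t : 0 < a -> 0 < c ->
  time_potential a (fun tau => expR (c * tau)) t = (c `^ (- a) * expR (c * t))%:E.
Proof.
move=> a0 c0; have Ga := Gamma_gt0 a0.
have m1 : measurable_fun [set: R] (fun x => (ppow (a - 1) x * expR (- (c * x)))%:E).
  by apply/measurable_EFinP; exact: measurable_ppow_exp.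
have g1 x : (0 <= (ppow (a - 1) x * expR (- (c * x)))%:E)%E.
  by rewrite lee_fin mulr_ge0 ?ppow_ge0 ?expR_ge0.
have I1 : (\int[leb]_x (ppow (a - 1) x * expR (- (c * x)))%:E = (c `^ (- a) * Gamma a)%:E)%E.
  have := ge0_integral_scale c0 (measurable_gamma_integrand (a - 1))
    (gamma_integrand_ge0 (a - 1)).
  rewrite -/(gamma_integral a) gamma_integralE//.
  under eq_integral do rewrite ppow_scale// -mulrA EFinM.
  rewrite ge0_integralZl//; last by rewrite lee_fin powR_ge0.
  move/(congr1 (fun x : \bar R => (c `^ (a - 1))^-1%:E * x)%E).
  rewrite muleA -!EFinM mulVf ?gt_eqF ?powR_gt0// mul1e => ->; congr EFin.
  rewrite mulrA -powRN -[c^-1](powR_inv1 (ltW c0)) -powRD; last by rewrite (gt_eqF c0) implybT.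
  by congr (_ `^ _ * _); ring.
rewrite /time_potential.
transitivity ((expR (c * t) / Gamma a)%:E * (c `^ (- a) * Gamma a)%:E)%E; last first.
  by rewrite -EFinM; congr EFin; field; rewrite gt_eqF.
rewrite -I1 -(ge0_integral_reflect t m1 g1) -ge0_integralZl//; last 2 first.
- have mt : measurable_fun [set: R] (fun y => t - y) by exact: measurable_funB.
  exact: (measurableT_comp m1 mt).
- by rewrite lee_fin divr_ge0 ?expR_ge0// ltW.
apply: eq_integral => tau _; rewrite -EFinM; congr EFin.
have -> : expR (c * tau) = expR (c * t) * expR (- (c * (t - tau))).
  by rewrite -expRD; congr expR; ring.
by ring.
Qed.

End riemann_liouville.
(** * The heat kernel *)

Section heat_kernel.
Set Implicit Arguments.
Unset Strict Implicit.
Context {R : realType}.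
Local Notation mR := (measurableTypeR R).
Local Notation leb := (@lebesgue_measure R).

Lemma measurable_prod_normal_pdf n (m : 'I_n -> R) (s : R) :
  measurable_fun setT (fun x : n.-tuple mR => \prod_(i < n) normal_pdf (m i) s (tnth x i)).
Proof.
apply: measurable_prod => i _.
exact: (measurableT_comp (measurable_normal_pdf _ _) (measurable_tnth i)).
Qed.

(** This gives the heat kernel its unit mass in space. The induction follows the recursive
    construction of [lebesgue_Rn], splitting off one coordinate by Tonelli. *)
Lemma integral_prod_normal_pdf n (m : 'I_n -> R) (s : R) : s != 0 ->
  (\int[lebesgue_Rn n]_x (\prod_(i < n) normal_pdf (m i) s (tnth x i))%:E = 1)%E.
Proof.
move=> s0; elim: n m => [|n IH] m.
  rewrite [LHS](@integral_dirac _ (0.-tuple mR) [tuple] R setT)//.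
    by rewrite diracT mul1e big_ord0.
  by apply/measurable_EFinP; exact: measurable_prod_normal_pdf.
have mf := @measurable_prod_normal_pdf n.+1 m s.
have p0 k (m' : 'I_k -> R) (x : k.-tuple mR) :
    0 <= \prod_(i < k) normal_pdf (m' i) s (tnth x i).
  by apply: prodr_ge0 => i _; exact: normal_pdf_ge0.
rewrite [LHS](@ge0_integral_pushforward _ _ (mR * n.-tuple mR)%type (n.+1.-tuple mR) R
  (@tcons R n) (@measurable_tcons R n) (leb \x lebesgue_Rn n)%E)//=; last first.
- by move=> x _; rewrite lee_fin; exact: p0.
- exact/measurable_EFinP.
rewrite preimage_setT fubini_tonelli1//=; last 2 first.
- apply/measurable_EFinP; apply: (measurableT_comp mf); exact: measurable_tcons.
- by move=> z; rewrite lee_fin; exact: p0.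
transitivity (\int[leb]_a (normal_pdf (m ord0) s a)%:E)%E; last exact: integral_normal_pdf.
apply: eq_integral => a _; rewrite /fubini_F/=.
transitivity (\int[lebesgue_Rn n]_x ((normal_pdf (m ord0) s a)%:E *
    (\prod_(i < n) normal_pdf (m (lift ord0 i)) s (tnth x i))%:E))%E.
  apply: eq_integral => x _; rewrite -EFinM big_ord_recl/=; congr (_ * _)%:E.
  by apply: eq_bigr => i _; rewrite tnthS.
rewrite ge0_integralZl//; last 3 first.
- by apply/measurable_EFinP; exact: measurable_prod_normal_pdf.
- by move=> x _; rewrite lee_fin; exact: p0.
- by rewrite lee_fin normal_pdf_ge0.
by rewrite IH mule1.
Qed.

(** For t > 0 the heat kernel is a product of Gaussian densities of variance 2 t, and by symmetry
    [x] may serve as their centre; for t <= 0 both sides vanish. *)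
Lemma frac_heat_kernelE n (alpha : R) (x y : n.-tuple mR) (t : R) :
  frac_heat_kernel alpha [tuple tnth x i - tnth y i | i < n] t =
  ppow (alpha - 1) t / Gamma alpha *
    \prod_(i < n) normal_pdf (tnth x i) (Num.sqrt (2 * t)) (tnth y i).
Proof.
rewrite /frac_heat_kernel; have [t0|t0] := leP t 0.
  rewrite ppow_npos// !mul0r indicE memNset/= ?mulr0// in_itv/= andbT.
  by apply/negP; rewrite -leNgt.
rewrite ppow_pos// indicE mem_set/= ?mulr1; last by rewrite in_itv/= t0.
rewrite -mulrA; congr (_ * _).
have s0 : Num.sqrt (2 * t) != 0 by rewrite gt_eqF// sqrtr_gt0 mulr_gt0.
under eq_bigr do rewrite normal_pdfE//.
rewrite big_split/= prodr_const card_ord /normal_fun /normal_peak sqr_sqrtr; last first.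
  by rewrite mulr_ge0// ltW.
congr (_ * _).
  rewrite [n%:R / 2]mulrC powRrM powR12_sqrt; last by rewrite !mulr_ge0// ?pi_ge0// ltW.
  rewrite powR_mulrn ?sqrtr_ge0// -exprVn; congr (_^-1 ^+ _); congr Num.sqrt.
  by rewrite -mulr_natr; ring.
rewrite -expR_sum; congr expR; rewrite /sqnorm mulr_suml -sumrN.
apply: eq_bigr => i _; rewrite tnth_mktuple -[2 * t *+ 2]mulr_natr.
by field; rewrite gt_eqF.
Qed.

Lemma measurable_frac_heat_kernel n (alpha : R) (z : spacetime R n) :
  measurable_fun setT (fun w : spacetime R n =>
    frac_heat_kernel alpha [tuple tnth z.1 i - tnth w.1 i | i < n] (z.2 - w.2)).
Proof.
have mt : measurable_fun setT (fun w : spacetime R n => z.2 - w.2) by exact: measurable_funB.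
(* Reciprocals become powers with negative exponents, whose measurability is known. The two formulas
   agree for positive times, and both vanish otherwise. *)
apply: (eq_measurable_fun (fun w : spacetime R n =>
  ppow (alpha - 1) (z.2 - w.2) / Gamma alpha * (4 * pi * (z.2 - w.2)) `^ (- (n%:R / 2)) *
  expR (- ((\sum_(i < n) (tnth z.1 i - tnth w.1 i) ^+ 2) * (4 * (z.2 - w.2)) `^ (- 1))))).
  move=> w _; rewrite /frac_heat_kernel; set t := z.2 - w.2.
  have [t0|t0] := leP t 0.
    rewrite ppow_npos// !mul0r indicE memNset/= ?mulr0// in_itv/= andbT.
    by apply/negP; rewrite -leNgt.
  rewrite ppow_pos// indicE mem_set/= ?mulr1; last by rewrite in_itv/= t0.
  rewrite powRN powR_inv1; last by rewrite mulr_ge0// ltW.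
  by under [sqnorm _]eq_bigr do rewrite tnth_mktuple.
apply: measurable_funM; first apply: measurable_funM; first apply: measurable_funM => //.
- exact: measurable_ppow_comp.
- apply: (measurableT_comp (measurable_powR _)); exact: measurable_funM.
apply: measurableT_comp => //; apply: measurableT_comp => //.
apply: measurable_funM.
  apply: measurable_sum => i; apply: measurable_funX; apply: measurable_funB => //.
  exact: (measurableT_comp (measurable_tnth i)).
apply: (measurableT_comp (measurable_powR _)); exact: measurable_funM.
Qed.

Lemma frac_heat_kernel_ge0 n (alpha : R) (x : n.-tuple R) (t : R) : 0 < alpha ->
  0 <= frac_heat_kernel alpha x t.
Proof.
move=> a0; rewrite /frac_heat_kernel !mulr_ge0 ?powR_ge0 ?invr_ge0 ?expR_ge0 ?powR_ge0//.
by rewrite ltW// Gamma_gt0.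
Qed.

(** At the critical order alpha - 1 = n/2, so the power of t cancels against the heat kernel
    normalisation, and the Gaussian factor is at most 1. *)
Lemma frac_heat_kernel_critical_le n (x : n.-tuple R) (t : R) :
  frac_heat_kernel ((n%:R + 2) / 2) x t <=
    (Gamma ((n%:R + 2) / 2 : R) * (4 * pi) `^ (n%:R / 2))^-1.
Proof.
have G : 0 < Gamma ((n%:R + 2) / 2 : R) by rewrite Gamma_gt0// divr_gt0// ltr_wpDl.
have C0 : 0 < (4 * pi : R) `^ (n%:R / 2) by rewrite powR_gt0// mulr_gt0// pi_gt0.
rewrite /frac_heat_kernel indicE; have [t0|t0] := leP t 0.
  rewrite memNset/= ?mulr0 ?invr_ge0 ?mulr_ge0 ?powR_ge0 ?(ltW G)// in_itv/= andbT.
  by apply/negP; rewrite -leNgt.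
rewrite mem_set/= ?mulr1; last by rewrite in_itv/= t0.
have -> : (n%:R + 2) / 2 - 1 = n%:R / 2 :> R by field.
rewrite [(4 * pi * t) `^ _]powRM ?(ltW t0)//; last by rewrite mulr_ge0// pi_ge0.
have tn : 0 < t `^ (n%:R / 2) by rewrite powR_gt0.
rewrite [X in X * expR _](_ : _ = (Gamma ((n%:R + 2) / 2 : R) * (4 * pi) `^ (n%:R / 2))^-1).
  rewrite ler_piMr ?invr_ge0 ?mulr_ge0 ?powR_ge0 ?(ltW G)//.
  rewrite -expR0 ler_expR oppr_le0 divr_ge0 ?mulr_ge0 ?(ltW t0)//.
  by apply: sumr_ge0 => i _; exact: sqr_ge0.
by field; rewrite !gt_eqF.
Qed.

End heat_kernel.
(** * Fractional heat potentials *)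

Section heat_potential.
Set Implicit Arguments.
Unset Strict Implicit.
Context {R : realType} (n : nat).
Local Notation leb := (@lebesgue_measure R).
Local Notation mu := (lebesgue_spacetime n : {measure set (spacetime R n) -> \bar R}).
Implicit Types (f g : spacetime R n -> R) (z w : spacetime R n).

Lemma measurable_before (t : R) : measurable [set w : spacetime R n | w.2 < t].
Proof.
rewrite [X in measurable X](_ : _ = setT `&` snd @^-1` `]-oo, t[%classic).
  by apply: measurable_snd => //; exact: measurable_itv.
by rewrite setTI; apply/seteqP; split => w /=; rewrite in_itv.
Qed.

Lemma measurable_J_integrand (alpha : R) f z : measurable_fun setT f ->
  measurable_fun setT (fun w => (frac_heat_kernel alpha
    [tuple tnth z.1 i - tnth w.1 i | i < n] (z.2 - w.2) * f w)%:E).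
Proof.
move=> mf; apply/measurable_EFinP; apply: measurable_funM => //.
exact: measurable_frac_heat_kernel.
Qed.

Lemma J_ge0 (alpha : R) f z : 0 < alpha -> (forall w, 0 <= f w) -> (0 <= J alpha f z)%E.
Proof.
move=> a0 f0; apply: integral_ge0 => w _; rewrite lee_fin mulr_ge0//.
exact: frac_heat_kernel_ge0.
Qed.

Lemma ae_eq_J (alpha : R) f g z : measurable_fun setT f -> measurable_fun setT g ->
  (\forall w \ae mu, f w = g w) -> J alpha f z = J alpha g z.
Proof.
move=> mf mg fg; apply: ae_eq_integral.
- exact: measurable_before.
- by apply: measurable_funTS; exact: measurable_J_integrand.
- by apply: measurable_funTS; exact: measurable_J_integrand.
by apply: filterS fg => w -> _.
Qed.

Lemma J_time (alpha : R) (phi : R -> R) z : 0 < alpha ->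
  measurable_fun setT phi -> (forall t, 0 <= phi t) ->
  J alpha (fun w => phi w.2) z = time_potential alpha phi z.2.
Proof.
move=> a0 mphi phi0.
have mphi2 : measurable_fun setT (fun w : spacetime R n => phi w.2).
  exact: measurableT_comp.
have G := Gamma_gt0 a0.
rewrite /J integral_mkcond.
transitivity (\int[lebesgue_Rn n \x leb]_w (frac_heat_kernel alpha
    [tuple tnth z.1 i - tnth w.1 i | i < n] (z.2 - w.2) * phi w.2)%:E)%E.
  apply: eq_integral => w _; rewrite patchE; case: ifPn => //.
  rewrite notin_setE/= => /negP; rewrite -leNgt => zw.
  by rewrite frac_heat_kernelE ppow_npos ?mul0r// subr_le0.
rewrite fubini_tonelli2//; last 2 first.
- exact: (measurable_J_integrand alpha z mphi2).
- by move=> w; rewrite lee_fin mulr_ge0// frac_heat_kernel_ge0.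
apply: eq_integral => tau _; rewrite /fubini_G/=.
have [zt|zt] := leP (z.2 - tau) 0.
  rewrite (ppow_npos _ zt) !mul0r; apply: integral0_eq => x _.
  by rewrite frac_heat_kernelE ppow_npos ?mul0r.
transitivity (\int[lebesgue_Rn n]_x (
   (ppow (alpha - 1) (z.2 - tau) / Gamma alpha * phi tau)%:E *
   (\prod_(i < n) normal_pdf (tnth z.1 i) (Num.sqrt (2 * (z.2 - tau))) (tnth x i))%:E))%E.
  by apply: eq_integral => x _; rewrite frac_heat_kernelE -EFinM mulrAC.
rewrite ge0_integralZl//; last 3 first.
- by apply/measurable_EFinP; exact: measurable_prod_normal_pdf.
- by move=> x _; rewrite lee_fin; apply: prodr_ge0 => i _; exact: normal_pdf_ge0.
- by rewrite lee_fin mulr_ge0// mulr_ge0 ?ppow_ge0// invr_ge0 ltW.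
by rewrite integral_prod_normal_pdf ?mule1// gt_eqF// sqrtr_gt0 mulr_gt0.
Qed.

(** Causality: only the values of [f] before time [z.2] enter, so a bound valid below a time T can
    be propagated without leaving that region. *)
Lemma J_le_time_potential (alpha : R) f (phi : R -> R) z : 0 < alpha ->
  measurable_fun setT f -> (forall w, 0 <= f w) ->
  measurable_fun setT phi -> (forall t, 0 <= phi t) ->
  (\forall w \ae mu, w.2 < z.2 -> f w <= phi w.2) ->
  (J alpha f z <= time_potential alpha phi z.2)%E.
Proof.
move=> a0 mf f0 mphi phi0 fphi; rewrite -(J_time z)//.
have mphi2 : measurable_fun setT (fun w : spacetime R n => phi w.2).
  exact: measurableT_comp.
apply: ae_ge0_le_integral.
- exact: measurable_before.
- by move=> w _; rewrite lee_fin mulr_ge0// frac_heat_kernel_ge0.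
- by apply: measurable_funTS; exact: measurable_J_integrand.
- by move=> w _; rewrite lee_fin mulr_ge0// frac_heat_kernel_ge0.
- by apply: measurable_funTS; exact: (measurable_J_integrand alpha z mphi2).
apply: (@filterS _ _ (ae_filter_ringOfSetsType mu)) fphi => w fphi /= wz.
by rewrite lee_fin ler_wpM2l ?frac_heat_kernel_ge0// fphi.
Qed.

(** The constant is the supremum bound of the critical kernel times the L^1 norm of [f] before T. *)
Lemma J_critical_bounded f g (T : R) : Xspace 1 f ->
  measurable_fun setT g -> (forall w, 0 <= g w <= `|f w|) ->
  exists2 K : R, 0 <= K & forall z, z.2 <= T -> (J ((n%:R + 2) / 2) g z <= K%:E)%E.
Proof.
move=> [mf /(_ T)]; rewrite /finite_norm Lnorm1 => fT mg gf.
set I := (\int[_]_x _)%E in fT.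
have I0 : (0 <= I)%E by apply: integral_ge0.
pose C : R := (Gamma ((n%:R + 2) / 2 : R) * (4 * pi) `^ (n%:R / 2))^-1.
have a0 : 0 < (n%:R + 2) / 2 :> R by rewrite divr_gt0// ltr_wpDl.
have C0 : 0 <= C.
  by rewrite invr_ge0 mulr_ge0 ?powR_ge0// ltW// Gamma_gt0.
have g0 w : 0 <= g w by have /andP[] := gf w.
exists (C * fine I); first by rewrite mulr_ge0// fine_ge0.
move=> z zT; rewrite EFinM fineK ?ge0_fin_numE//.
have mfT : measurable_fun setT (fun w => f w * \1_[set w : spacetime R n | w.2 < T] w).
  by apply: measurable_funM => //; apply: measurable_indic; exact: measurable_before.
have mI : measurable_fun setT (fun w =>
    `|(f w * \1_[set w : spacetime R n | w.2 < T] w)%:E|%E).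
  by apply: measurableT_comp => //; exact/measurable_EFinP.
rewrite /I -ge0_integralZl// /J [leLHS]integral_mkcond; apply: ge0_le_integral => //.
- move=> w _; apply: erestrict_ge0 => {}w _; rewrite lee_fin mulr_ge0//.
  exact: frac_heat_kernel_ge0.
- apply/(measurable_restrictT _ _).1; first exact: measurable_before.
  by apply: measurable_funTS; exact: measurable_J_integrand.
- exact: measurable_funeM.
move=> w _; rewrite patchE; case: ifPn => [|_]; last by rewrite mule_ge0.
rewrite inE/= => wz; rewrite indicE mem_set/= ?mulr1; last by exact: lt_le_trans zT.
rewrite lee_fin ler_pM ?frac_heat_kernel_ge0//; last by have /andP[] := gf w.
exact: frac_heat_kernel_critical_le.
Qed.

End heat_potential.
(** * Comparison with functions of time *)

Section comparison.
Set Implicit Arguments.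
Unset Strict Implicit.
Context {R : realType} (n : nat).
Local Notation mu := (lebesgue_spacetime n : {measure set (spacetime R n) -> \bar R}).
Local Notation aeS := (@filterS _ _ (ae_filter_ringOfSetsType mu)).
Local Notation aeS3 := (@filterS3 _ _ (ae_filter_ringOfSetsType mu)).
Implicit Types (f g u v : spacetime R n -> R) (z w : spacetime R n) (phi psi : R -> R).

Lemma measurable_pos f : measurable_fun setT f ->
  measurable_fun setT (fun w => Num.max (f w) 0).
Proof. by move=> mf; exact: measurable_maxr. Qed.

(** Turns almost everywhere nonnegativity into the pointwise one needed for the comparison lemmas,
    with equality of the potentials at every point. *)
Lemma J_pos (alpha : R) f z : measurable_fun setT f ->
  (\forall w \ae mu, 0 <= f w) -> J alpha f z = J alpha (fun w => Num.max (f w) 0) z.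
Proof.
move=> mf f0; apply: ae_eq_J => //; first exact: measurable_pos.
by apply: aeS f0 => w f0; rewrite max_l.
Qed.

Lemma heat_potential_ge0 (alpha : R) u f : 0 < alpha -> measurable_fun setT f ->
  (\forall z \ae mu, (u z)%:E = J alpha f z) -> (\forall z \ae mu, 0 <= f z) ->
  \forall z \ae mu, 0 <= u z.
Proof.
move=> a0 mf uf f0; apply: aeS uf => z uz.
rewrite -lee_fin uz J_pos//; apply: J_ge0 => // w.
by rewrite le_max lexx orbT.
Qed.

Lemma heat_potential_eq0 (alpha : R) u f : measurable_fun setT f ->
  (\forall z \ae mu, (u z)%:E = J alpha f z) -> (\forall z \ae mu, f z = 0) ->
  \forall z \ae mu, u z = 0.
Proof.
move=> mf uf f0; apply: aeS uf => z uz; apply/EFin_inj.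
rewrite uz (@ae_eq_J _ _ _ f (cst 0))// /J.
by apply: integral0_eq => w _; rewrite mulr0.
Qed.

Lemma heat_potential_critical_bounded u f (T : R) : Xspace 1 f ->
  (\forall z \ae mu, (u z)%:E = J ((n%:R + 2) / 2) f z) -> (\forall z \ae mu, 0 <= f z) ->
  exists2 K : R, 0 <= K & \forall z \ae mu, z.2 < T -> u z <= K.
Proof.
move=> Xf uf f0; have mf : measurable_fun setT f by case: Xf.
have [w|K K0 JK] := J_critical_bounded T Xf (measurable_pos mf).
  by rewrite le_max lexx orbT ge_max ler_norm normr_ge0.
exists K => //; apply: aeS uf => z uz zT.
by rewrite -lee_fin uz J_pos// JK// ltW.
Qed.

Lemma time_potentialZ (alpha c : R) phi t : 0 < alpha -> 0 <= c ->
  measurable_fun setT phi -> (forall t, 0 <= phi t) ->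
  time_potential alpha (fun tau => c * phi tau) t = (c%:E * time_potential alpha phi t)%E.
Proof.
move=> a0 c0 mphi phi0; have G := Gamma_gt0 a0.
rewrite /time_potential -ge0_integralZl//.
- by apply: eq_integral => tau _; rewrite -EFinM mulrCA.
- apply/measurable_EFinP; apply: measurable_funM => //; apply: measurable_funM => //.
  by apply: measurable_ppow_comp; exact: measurable_funB.
- by move=> tau _; rewrite lee_fin mulr_ge0// divr_ge0 ?ppow_ge0// ltW.
Qed.

(** Half a turn through the system. The exponent [s] and the factor [K] are kept free, so that a
    nonlinearity may first be dominated by a different power. *)
Lemma heat_potential_step (alpha K m c s T : R) u f v phi psi :
  0 < alpha -> 0 <= K -> 0 <= m -> 0 <= s -> measurable_fun setT f ->
  measurable_fun setT phi -> (forall t, 0 <= phi t) ->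
  (\forall z \ae mu, (u z)%:E = J alpha f z) ->
  (\forall z \ae mu, 0 <= f z) -> (\forall z \ae mu, 0 <= v z) ->
  (\forall z \ae mu, z.2 < T -> f z <= K * v z `^ s) ->
  (\forall z \ae mu, z.2 < T -> v z <= m * phi z.2) ->
  (forall t, time_potential alpha (fun tau => phi tau `^ s) t = (c * psi t)%:E) ->
  \forall z \ae mu, z.2 < T -> u z <= K * m `^ s * c * psi z.2.
Proof.
move=> a0 K0 m0 s0 mf mphi phi0 uf f0 v0 fv vphi tp.
have mphis : measurable_fun setT (fun tau => phi tau `^ s).
  exact: (measurableT_comp (measurable_powR _)).
have fphi : \forall z \ae mu, z.2 < T -> Num.max (f z) 0 <= K * m `^ s * phi z.2 `^ s.
  apply: aeS3 v0 fv vphi => z vz0 fv vphi zT.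
  rewrite ge_max -mulrA -powRM//; apply/andP; split; last by rewrite mulr_ge0// powR_ge0.
  apply: le_trans (fv zT) _; rewrite ler_wpM2l// ge0_ler_powR// ?nnegrE// ?mulr_ge0//.
  exact: vphi.
apply: aeS uf => z uz zT; rewrite -lee_fin uz J_pos//.
apply: (@le_trans _ _ (time_potential alpha (fun tau => K * m `^ s * phi tau `^ s) z.2)).
  apply: J_le_time_potential => //.
  - exact: measurable_pos.
  - by move=> w; rewrite le_max lexx orbT.
  - exact: measurable_funM.
  - by move=> t; rewrite !mulr_ge0 ?powR_ge0.
  by apply: aeS fphi => w fphi wz; apply: fphi; exact: lt_trans zT.
rewrite time_potentialZ ?mulr_ge0 ?powR_ge0//; last by move=> t; exact: powR_ge0.
by rewrite tp -EFinM !mulrA.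
Qed.

(** Taking b = a + 1/(k + 1) makes the exceptional sets countably many; off their union the limit is
    taken pointwise. *)
Lemma ae_le_closure u phi (a T : R) : (forall t, 0 <= phi t) ->
  (forall b, a < b -> \forall z \ae mu, z.2 < T -> u z <= b * phi z.2) ->
  \forall z \ae mu, z.2 < T -> u z <= a * phi z.2.
Proof.
move=> phi0 H.
have : \forall z \ae mu, forall k : nat, z.2 < T -> u z <= (a + k.+1%:R^-1) * phi z.2.
  by apply: ae_foralln => k; apply: H; rewrite ltrDl.
apply: aeS => z uz zT; apply/ler_addgt0Pr => e e0.
have p1 : 0 < phi z.2 + 1 by rewrite ltr_wpDl.
pose k := Num.truncn (e / (phi z.2 + 1))^-1.
apply: le_trans (uz k zT) _; rewrite mulrDl lerD2l.
have : k.+1%:R^-1 <= e / (phi z.2 + 1).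
  by rewrite invf_ple ?posrE ?divr_gt0// ltW// truncnS_gt.
rewrite ler_pdivlMr//; apply: le_trans.
by rewrite ler_wpM2l// lerDl.
Qed.

End comparison.

(* The infimum of [S] cannot exceed [A]: an element of [S] close to it would be
   mapped by [F] below it. *)
Lemma self_improvement (R : realType) (S : set R) (F : R -> R) (A K : R) :
  (forall m, S m -> 0 <= m) -> (forall a b, a <= b -> S a -> S b) -> S K ->
  (forall m, S m -> S (F m)) -> (forall a b, 0 <= a <= b -> F a <= F b) ->
  (forall a, A < a -> exists2 b, a < b & F b < a) ->
  forall a, A < a -> S a.
Proof.
move=> S0 Sup SK SF Fmono FA.
have infS : has_inf S by split; [exists K|exists 0 => m /S0].
have iA : inf S <= A.
  rewrite leNgt; apply/negP => /FA[b ib Fbi].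
  have [m Sm mb] := inf_lt infS.1 ib.
  have : F m < inf S by apply: le_lt_trans Fbi; rewrite Fmono// S0//= ltW.
  by rewrite ltNge => /negP; apply; apply: ge_inf (SF _ Sm); exact: infS.2.
move=> a Aa; have [m Sm ma] := inf_lt infS.1 (le_lt_trans iA Aa).
exact: Sup (ltW ma) Sm.
Qed.

(** * The constants of the a priori bounds *)

(** The constant for [v] is the image, under half a turn, of the fixed point that bounds [u]; the
    exponents of c1 match since l s / (1 - l s) + 1 = 1 / (1 - l s). *)
Lemma fixed_point_constant (R : realType) (c1 c2 l s : R) : 0 < c1 -> 0 < c2 -> 0 < s ->
  l * s < 1 ->
  (c2 * c1 `^ s^-1) `^ (s / (1 - l * s)) = ((c1 `^ l * c2) `^ (1 - l * s)^-1) `^ s * c1.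
Proof.
move=> c1_gt0 c2_gt0 s0; rewrite -subr_gt0 => ls.
rewrite !powRM ?powR_ge0 ?(ltW c1_gt0) ?(ltW c2_gt0)// -!powRrM.
rewrite mulrC mulrAC [_^-1 * s]mulrC; congr (_ * _).
rewrite -[X in _ = _ * X](powRr1 (ltW c1_gt0)) -powRD; last by rewrite (gt_eqF c1_gt0) implybT.
by congr (_ `^ _); field; rewrite !gt_eqF.
Qed.

Lemma mulf_div_powR (R : realType) (a b c d r : R) : 0 < a -> 0 < b -> 0 < c -> 0 < d ->
  a * b `^ r / (c * d `^ r) = a / c * (b / d) `^ r.
Proof.
move=> a0 b0 c0 d0; rewrite powRM ?invr_ge0 ?ltW// -(powR_inv1 (ltW d0)) powRAC.
by rewrite powR_inv1 ?powR_ge0//; field; rewrite !gt_eqF// powR_gt0.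
Qed.

(** * The system of inequalities *)

Section system.
Set Implicit Arguments.
Unset Strict Implicit.
Context {R : realType} (n : nat).
Local Notation mu := (lebesgue_spacetime n : {measure set (spacetime R n) -> \bar R}).
Local Notation aeS := (@filterS _ _ (ae_filter_ringOfSetsType mu)).
Local Notation aeS2 := (@filterS2 _ _ (ae_filter_ringOfSetsType mu)).
Variables (lambda sigma alpha beta : R) (u v f g : spacetime R n -> R).
Hypotheses (l0 : 0 < lambda) (s0 : 0 < sigma) (a0 : 0 < alpha) (b0 : 0 < beta).
Hypotheses (mf : measurable_fun setT f) (mg : measurable_fun setT g).
Hypothesis uf : \forall z \ae mu, (u z)%:E = J alpha f z.
Hypothesis vg : \forall z \ae mu, (v z)%:E = J beta g z.
Hypothesis fv : \forall z \ae mu, 0 <= f z <= v z `^ lambda.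
Hypothesis gu : \forall z \ae mu, 0 <= g z <= u z `^ sigma.
Hypothesis uneg : \forall z \ae mu, z.2 < 0 -> u z = 0.

Let f0 : \forall z \ae mu, 0 <= f z.
Proof. by apply: aeS fv => z /andP[]. Qed.

Let g0 : \forall z \ae mu, 0 <= g z.
Proof. by apply: aeS gu => z /andP[]. Qed.

Let u0 : \forall z \ae mu, 0 <= u z.
Proof. exact: heat_potential_ge0 a0 mf uf f0. Qed.

Let v0 : \forall z \ae mu, 0 <= v z.
Proof. exact: heat_potential_ge0 b0 mg vg g0. Qed.

(** A full turn, from [u] to [v] and back to [u], for weights that the two potentials map to one
    another. *)
Lemma system_step (K m c1 c2 s T : R) (w w1 : R -> R) :
  0 <= K -> 0 <= m -> 0 <= c1 -> 0 <= s ->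
  measurable_fun setT w -> (forall t, 0 <= w t) ->
  measurable_fun setT w1 -> (forall t, 0 <= w1 t) ->
  (\forall z \ae mu, z.2 < T -> u z `^ sigma <= K * u z `^ s) ->
  (forall t, time_potential beta (fun tau => w tau `^ s) t = (c1 * w1 t)%:E) ->
  (forall t, time_potential alpha (fun tau => w1 tau `^ lambda) t = (c2 * w t)%:E) ->
  (\forall z \ae mu, z.2 < T -> u z <= m * w z.2) ->
  (\forall z \ae mu, z.2 < T -> v z <= K * m `^ s * c1 * w1 z.2) /\
  (\forall z \ae mu, z.2 < T -> u z <= (K * m `^ s * c1) `^ lambda * c2 * w z.2).
Proof.
move=> K0 m0 c10 s_ge0 mw w0 mw1 w10 uK tb ta um.
have vm : \forall z \ae mu, z.2 < T -> v z <= K * m `^ s * c1 * w1 z.2.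
  apply: (heat_potential_step b0 K0 m0 s_ge0 mg mw w0 vg g0 u0 _ um tb).
  by apply: aeS2 gu uK => z /andP[_ gz] uz zT; apply: le_trans gz _; exact: uz.
split => //; rewrite -[_ `^ lambda]mul1r.
apply: (heat_potential_step a0 ler01 _ (ltW l0) mf mw1 w10 uf f0 v0 _ vm ta).
  by rewrite !mulr_ge0 ?powR_ge0.
by apply: aeS fv => z /andP[_ fz] _; rewrite mul1r.
Qed.

(* As [u] is bounded, [u `^ sigma] is dominated by a multiple of
   [u `^ lambda^-1]. Against the weight [expR (L * t)] one turn through the
   system then multiplies the bound of [u] by a constant times
   [L `^ - (alpha + beta * lambda)]; [L] is chosen to make this factor 1/2. *)
Lemma system_vanish (T : R) : 1 <= lambda * sigma ->
  (exists K, \forall z \ae mu, z.2 < T -> u z <= K) ->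
  \forall z \ae mu, z.2 < T -> u z = 0.
Proof.
move=> ls [K' uK']; pose K := `|K'| + 1.
have K0 : 0 < K by rewrite ltr_wpDl.
have uK : \forall z \ae mu, z.2 < T -> u z <= K.
  apply: aeS uK' => z uK zT; apply: le_trans (uK zT) _.
  by rewrite (le_trans (ler_norm _))// lerDl.
(* With this exponent a turn is linear in m, because (m^s)^lambda = m; the assumption lambda sigma
   >= 1 says that s <= sigma. *)
pose s := lambda^-1; have s_gt0 : 0 < s by rewrite invr_gt0.
have ssig : s <= sigma by rewrite -[s]mul1r ler_pdivrMr// mulrC.
pose C := K `^ (sigma - s); have C0 : 0 < C by rewrite powR_gt0.
(* A turn multiplies the bound by (Q / 2) L^(- (alpha + beta lambda)), which is 1/2 once L^(alpha +
   beta lambda) = Q. *)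
pose Q := 2 * C `^ lambda * (s `^ (- beta)) `^ lambda.
have Q0 : 0 < Q by rewrite !mulr_gt0 ?powR_gt0.
have abl : 0 < alpha + beta * lambda by rewrite addr_gt0// mulr_gt0.
pose L := Q `^ (alpha + beta * lambda)^-1.
have L0 : 0 < L by rewrite powR_gt0.
pose w (t : R) := expR (L * t); pose w1 (t : R) := expR (s * L * t).
have mexp (c : R) : measurable_fun setT (fun t : R => expR (c * t)).
  by apply: measurableT_comp => //; exact: measurable_funM.
have powexp (x y : R) : expR x `^ y = expR (y * x).
  by rewrite /powR gt_eqF ?expR_gt0// expRK.
have tb t : time_potential beta (fun tau => w tau `^ s) t = ((s * L) `^ (- beta) * w1 t)%:E.
  rewrite -time_potential_exp ?mulr_gt0//; congr time_potential; apply/funext => tau.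
  by rewrite powexp mulrA.
have ta t : time_potential alpha (fun tau => w1 tau `^ lambda) t = (L `^ (- alpha) * w t)%:E.
  rewrite -time_potential_exp//; congr time_potential; apply/funext => tau.
  by rewrite powexp !mulrA divff ?gt_eqF// mul1r.
have uC : \forall z \ae mu, z.2 < T -> u z `^ sigma <= C * u z `^ s.
  apply: aeS2 u0 uK => z uz uK zT.
  rewrite -[X in _ `^ X <= _](subrK s) powRD; last by rewrite subrK (gt_eqF s0).
  rewrite ler_wpM2r ?powR_ge0// ge0_ler_powR ?nnegrE ?subr_ge0 ?(ltW K0)//.
  exact: uK.
pose S : set R := [set m | 0 <= m /\ \forall z \ae mu, z.2 < T -> u z <= m * w z.2].
have Small a : 0 < a -> S a.
  apply: (@self_improvement R S (fun m => m / 2) 0 K).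
  - by move=> m [].
  - move=> a' b ab [a'0 ua]; split; first exact: le_trans ab.
    apply: aeS ua => z uz zT; apply: le_trans (uz zT) _.
    by rewrite ler_wpM2r// expR_ge0.
  - split; first exact: ltW.
    (* The start of the iteration: u vanishes at negative times, and the weight is at least 1
       afterwards. *)
    apply: aeS2 uK uneg => z uK un zT; have [z0|z0] := ltP z.2 0.
      by rewrite un// mulr_ge0 ?expR_ge0// ltW.
    apply: le_trans (uK zT) _; rewrite ler_peMr ?(ltW K0)//.
    by rewrite -expR0 ler_expR mulr_ge0// ltW.
  - move=> m [m0 um]; split; first by rewrite divr_ge0.
    have c10 : 0 <= (s * L) `^ (- beta) by exact: powR_ge0.
    have [_] := system_step (ltW C0) m0 c10 (ltW s_gt0) (mexp L) (fun t => expR_ge0 _)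
      (mexp (s * L)) (fun t => expR_ge0 _) uC tb ta um.
    apply: aeS => z uz zT; apply: le_trans (uz zT) _; rewrite ler_wpM2r ?expR_ge0//.
    rewrite !powRM ?mulr_ge0 ?powR_ge0 ?(ltW C0) ?(ltW s_gt0) ?(ltW L0)//.
    rewrite -[(m `^ s) `^ _]powRrM /s mulVf ?gt_eqF// powRr1// -/s.
    have LQ : L `^ (alpha + beta * lambda) = Q.
      by rewrite /L -powRrM mulVf ?gt_eqF// powRr1// ltW.
    have LLQ : (L `^ (- beta)) `^ lambda * L `^ (- alpha) = Q^-1.
      rewrite -powRrM -powRD; last by rewrite (gt_eqF L0) implybT.
      by rewrite -LQ -powRN; congr (_ `^ _); ring.
    have CL : 0 < C `^ lambda by rewrite powR_gt0.
    have sL : 0 < (s `^ (- beta)) `^ lambda by rewrite !powR_gt0.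
    move: LLQ; rewrite /Q.
    move: (C `^ lambda) ((s `^ (- beta)) `^ lambda) ((L `^ (- beta)) `^ lambda)
      (L `^ (- alpha)) CL sL => c d x y c0 d0 xy.
    have -> : c * m * (d * x) * y = c * m * d * (x * y) by ring.
    by rewrite xy le_eqVlt; apply/orP; left; apply/eqP; field; rewrite !gt_eqF.
  - by move=> a' b /andP[_ ab]; rewrite ler_pM2r.
  - move=> a' a'0; exists (3 / 2 * a'); lra.
have : \forall z \ae mu, z.2 < T -> u z <= 0 * w z.2.
  apply: ae_le_closure => [t|b bgt0]; first exact: expR_ge0.
  by have [] := Small b bgt0.
apply: aeS2 u0 => z uz0 uz zT; apply/eqP.
by rewrite eq_le uz0 andbT -[leRHS](mul0r (w z.2)) uz.
Qed.

(* The shift by [e] makes the weight bounded below on [t >= 0], so that the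
   boundedness of [u] starts the iteration, while the powers of [t + e] are
   still mapped to one another with the sharp constants. *)
Lemma system_bound (T e : R) : lambda * sigma < 1 -> 0 < e ->
  (exists K, \forall z \ae mu, z.2 < T -> u z <= K) ->
  let U := M2 lambda sigma alpha beta `^ (lambda / (1 - lambda * sigma)) in
  let V := M1 lambda sigma alpha beta `^ (sigma / (1 - lambda * sigma)) in
  (\forall z \ae mu, z.2 < T ->
    0 <= u z <= U * ppow (gamma2 lambda sigma alpha beta / sigma) (z.2 + e)) /\
  (\forall z \ae mu, z.2 < T ->
    0 <= v z <= V * ppow (gamma1 lambda sigma alpha beta / lambda) (z.2 + e)).
Proof.
move=> ls e0 [K' uK'] U V; pose K := `|K'| + 1.
have K0 : 0 < K by rewrite ltr_wpDl.
have uK : \forall z \ae mu, z.2 < T -> u z <= K.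
  apply: aeS uK' => z uK zT; apply: le_trans (uK zT) _.
  by rewrite (le_trans (ler_norm _))// lerDl.
pose G1 := gamma1 lambda sigma alpha beta; pose G2 := gamma2 lambda sigma alpha beta.
pose th := lambda * sigma.
have th0 : 0 < th by rewrite mulr_gt0.
have th1 : 0 < 1 - th by rewrite subr_gt0.
have G1_gt0 : 0 < G1 by rewrite divr_gt0// mulr_gt0// addr_gt0// mulr_gt0.
have G2_gt0 : 0 < G2 by rewrite divr_gt0// mulr_gt0// addr_gt0// mulr_gt0.
(* These identities make the weights reproduce each other: a power sigma followed by order beta
   takes the exponent G2 / sigma to G1 / lambda, and a power lambda followed by order alpha takes it
   back. *)
have bG : beta + G2 = G1 / lambda.
  by rewrite /G1 /G2 /gamma1 /gamma2; field; rewrite !gt_eqF.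
have aG : alpha + G1 = G2 / sigma.
  by rewrite /G1 /G2 /gamma1 /gamma2; field; rewrite !gt_eqF.
pose c1 := Gamma (G2 + 1) / Gamma (beta + G2 + 1).
pose c2 := Gamma (G1 + 1) / Gamma (alpha + G1 + 1).
have c1_gt0 : 0 < c1 by rewrite divr_gt0 ?Gamma_gt0 ?addr_gt0.
have c2_gt0 : 0 < c2 by rewrite divr_gt0 ?Gamma_gt0 ?addr_gt0.
pose w (t : R) := ppow (G2 / sigma) (t + e); pose w1 (t : R) := ppow (G1 / lambda) (t + e).
have mp (c : R) : measurable_fun setT (fun t : R => ppow c (t + e)).
  by apply: measurable_ppow_comp; exact: measurable_funD.
have tb t : time_potential beta (fun tau => w tau `^ sigma) t = (c1 * w1 t)%:E.
  rewrite /w1 -bG -time_potential_ppow ?(ltW G2_gt0)//; congr time_potential.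
  by apply/funext => tau; rewrite /w ppow_powR// divfK// gt_eqF.
have ta t : time_potential alpha (fun tau => w1 tau `^ lambda) t = (c2 * w t)%:E.
  rewrite /w -aG -time_potential_ppow ?(ltW G1_gt0)//; congr time_potential.
  by apply/funext => tau; rewrite /w1 ppow_powR// divfK// gt_eqF.
have step m : 0 <= m -> (\forall z \ae mu, z.2 < T -> u z <= m * w z.2) ->
    (\forall z \ae mu, z.2 < T -> v z <= 1 * m `^ sigma * c1 * w1 z.2) /\
    (\forall z \ae mu, z.2 < T -> u z <= (1 * m `^ sigma * c1) `^ lambda * c2 * w z.2).
  move=> m0 um; apply: (system_step ler01 m0 (ltW c1_gt0) (ltW s0) (mp _)
    (fun t => ppow_ge0 _ _) (mp _) (fun t => ppow_ge0 _ _) _ tb ta um).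
  by apply: aeS u0 => z _ _; rewrite mul1r.
pose Q := c1 `^ lambda * c2.
have Q0 : 0 < Q by rewrite mulr_gt0 ?powR_gt0.
have G_gt0 x : 0 < x -> 0 < Gamma (x + 1) by move=> x0; rewrite Gamma_gt0// addr_gt0.
have thk : (1 - th) != 0 by rewrite gt_eqF.
(* U is the positive fixed point of the map sending m to m^th Q that one full turn induces on
   bounds. *)
have UE : U = Q `^ (1 - th)^-1.
  have -> : U = (c1 * c2 `^ lambda^-1) `^ (lambda / (1 - th)).
    rewrite /U /M2 -/G1 -/G2; congr (_ `^ _).
    by rewrite mulf_div_powR ?G_gt0 ?addr_gt0.
  rewrite powRrM powRM ?powR_ge0 ?(ltW c1_gt0)// -[(c2 `^ _) `^ _]powRrM.
  by rewrite (mulVf (lt0r_neq0 l0)) (powRr1 (ltW c2_gt0)).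
have VE : V = U `^ sigma * c1.
  have -> : V = (c2 * c1 `^ sigma^-1) `^ (sigma / (1 - th)).
    rewrite /V /M1 -/G1 -/G2; congr (_ `^ _).
    by rewrite mulf_div_powR ?G_gt0 ?addr_gt0.
  by rewrite UE /Q fixed_point_constant.
have U0 : 0 < U by rewrite UE powR_gt0.
have UQ : U `^ (1 - th) = Q by rewrite UE -powRrM (mulVf thk) (powRr1 (ltW Q0)).
pose S : set R := [set m | 0 <= m /\ \forall z \ae mu, z.2 < T -> u z <= m * w z.2].
have Above a : U < a -> S a.
  (* For t >= 0 the weight is at least e^(G2 / sigma), so this multiple of it dominates the bound
     K. *)
  pose K1 := K / e `^ (G2 / sigma).
  have K10 : 0 <= K1 by rewrite divr_ge0 ?powR_ge0// ltW.
  apply: (@self_improvement R S (fun m => m `^ th * Q) U K1).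
  - by move=> m [].
  - move=> a' b ab [a'0 ua]; split; first exact: le_trans ab.
    apply: aeS ua => z uz zT; apply: le_trans (uz zT) _.
    by rewrite ler_wpM2r// ppow_ge0.
  - split=> //.
    apply: aeS2 uK uneg => z uK un zT; have [z0|z0] := ltP z.2 0.
      by rewrite un// mulr_ge0 ?ppow_ge0.
    apply: le_trans (uK zT) _; rewrite /K1 mulrAC ler_pdivlMr ?powR_gt0//.
    rewrite ler_wpM2l ?(ltW K0)// /w ppow_pos ?ltr_wpDl//.
    have Gs0 : 0 <= G2 / sigma by rewrite ltW// divr_gt0.
    by rewrite (ge0_ler_powR Gs0) ?nnegrE ?addr_ge0 ?(ltW e0)// lerDr.
  - move=> m [m0 um]; split; first by rewrite mulr_ge0 ?powR_ge0// ltW.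
    have [_] := step m m0 um; apply: aeS => z uz zT; apply: le_trans (uz zT) _.
    rewrite ler_wpM2r ?ppow_ge0// mul1r powRM ?powR_ge0 ?(ltW c1_gt0)//.
    by rewrite -powRrM -mulrA [sigma * _]mulrC.
  - move=> a' b /andP[a'0 ab]; rewrite ler_wpM2r ?(ltW Q0)//.
    by rewrite ge0_ler_powR ?nnegrE ?(ltW th0)// (le_trans a'0).
  - move=> a' Ua; have a'0 : 0 < a' by apply: lt_trans Ua.
    (* B is the point that the map sends to a'. Since a' lies above the fixed point, its own image
       is below a', hence B > a', and the midpoint of the two is a valid witness. *)
    pose B := (a' / Q) `^ th^-1.
    have B0 : 0 < B by rewrite powR_gt0// divr_gt0.
    have BE : B `^ th * Q = a'.
      by rewrite -powRrM mulVf ?gt_eqF// powRr1 ?divfK ?gt_eqF// divr_ge0 ?ltW.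
    have Fa : a' `^ th * Q < a'.
      have aE : a' = a' `^ th * a' `^ (1 - th).
        by rewrite -powRD ?(gt_eqF a'0) ?implybT// subrKC powRr1// ltW.
      by rewrite [ltRHS]aE -UQ ltr_pM2l ?powR_gt0// gt0_ltr_powR ?nnegrE ?ltW.
    have aB : a' < B.
      rewrite ltNge; apply/negP => Ba; move: Fa; rewrite ltNge => /negP; apply.
      rewrite -[leLHS]BE ler_wpM2r ?(ltW Q0)//.
      by rewrite (ge0_ler_powR (ltW th0)) ?nnegrE ?(ltW a'0) ?(ltW B0).
    have [ab bB] := midf_lt aB.
    exists ((a' + B) / 2) => //; rewrite -[ltRHS]BE ltr_pM2r//.
    by rewrite (gt0_ltr_powR th0) ?nnegrE ?(ltW B0)// (le_trans (ltW a'0))// ltW.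
have uU : \forall z \ae mu, z.2 < T -> u z <= U * w z.2.
  apply: ae_le_closure => [t|b bU]; first exact: ppow_ge0.
  by have [] := Above b bU.
split; first by apply: aeS2 u0 uU => z uz0 uUz zT; rewrite uz0 uUz.
have [vU _] := step U (ltW U0) uU.
apply: aeS2 v0 vU => z vz0 vUz zT; rewrite vz0 VE.
by apply: le_trans (vUz zT) _; rewrite mul1r.
Qed.

End system.

(** * Removal of the time shift and proof of the theorem *)

(** In place of a limit, e is chosen with (T + e)^a = T^a + d / (A + 1), which costs at most d. *)
Lemma ppow_shift_limit (R : realType) (x : \bar R) (A a T : R) : 0 <= A -> 0 < a -> 0 < T ->
  (forall e, 0 < e -> (x <= (A * (T + e) `^ a)%:E)%E) -> (x <= (A * T `^ a)%:E)%E.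
Proof.
move=> A0 a0 T0 H; apply/lee_addgt0Pr => d d0.
have A1 : 0 < A + 1 by rewrite ltr_wpDl.
pose y := T `^ a + d / (A + 1).
have dA : 0 < d / (A + 1) by rewrite divr_gt0.
have y0 : 0 < y by rewrite ltr_wpDl ?powR_ge0.
have ai : 0 < a^-1 by rewrite invr_gt0.
have yT : T < y `^ a^-1.
  rewrite -[ltLHS](powRr1 (ltW T0)) -(@mulfV _ a) ?gt_eqF// powRrM.
  by rewrite (gt0_ltr_powR ai) ?nnegrE ?powR_ge0 ?(ltW y0)// ltrDl.
have := H (y `^ a^-1 - T); rewrite subr_gt0 => /(_ yT); rewrite subrKC -powRrM mulVf ?gt_eqF//.
rewrite powRr1 ?(ltW y0)// => /le_trans; apply.
rewrite -EFinD lee_fin mulrDr lerD2l mulrCA ger_pMr// ler_pdivrMr// mul1r.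
by rewrite lerDl.
Qed.

Lemma Linfty_norm_le (R : realType) n (u : spacetime R n -> R) (A a T : R) :
  0 <= A -> 0 < a -> 0 < T ->
  (forall e, 0 < e -> \forall z \ae lebesgue_spacetime n, z.2 < T ->
    0 <= u z <= A * ppow a (z.2 + e)) ->
  (Linfty_norm u T <= (A * T `^ a)%:E)%E.
Proof.
move=> A0 a0 T0 H; apply: ppow_shift_limit => // e e0.
have B0 : 0 <= A * (T + e) `^ a by rewrite mulr_ge0 ?powR_ge0.
(* The norm is 0 by convention if the whole space is null; otherwise it is an essential supremum. *)
rewrite /Linfty_norm unlock; case: ifPn => _; last by rewrite lee_fin.
apply/ess_sup_inf.ess_supP.
apply: (@filterS _ _ (ae_filter_ringOfSetsType (lebesgue_spacetime n))) (H e e0) => z uz /=.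
rewrite lee_fin indicE; case: (boolP (z \in _)); last by rewrite mulr0 normr0.
rewrite inE/= => /andP[z0 zT]; rewrite mulr1.
have /andP[u0 uA] := uz zT; rewrite ger0_norm//; apply: le_trans uA _.
have ze : 0 < z.2 + e by rewrite addr_gt0.
rewrite ler_wpM2l// ppow_pos// (ge0_ler_powR (ltW a0)) ?nnegrE ?(ltW ze)//.
  by rewrite addr_ge0 ?ltW.
by rewrite lerD2r ltW.
Qed.

Lemma frac_heatP {R : realType} {n} {p alpha : R} {u : spacetime R n -> R} :
  Yspace p alpha u -> J_preimage p alpha u (frac_heat p alpha u).
Proof. exact: xgetPex. Qed.

Theorem theorem2p7 (R : realType) (n : nat) (p q lambda sigma alpha beta : R)
  (u v : spacetime R n -> R)
  (hn : (1 <= n)%N) (hp : 1 <= p) (hq : 1 <= q)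
  (hlambda : 0 < lambda) (hsigma : 0 < sigma)
  (halpha : 0 < alpha) (hbeta : 0 < beta)
  (hpalpha : admissible n p alpha) (hqbeta : admissible n q beta)
  (hexp : (n%:R + 2 - 2 * p * alpha) * q ^+ 2 * sigma
          <= (n%:R + 2 - 2 * q * beta) * p ^+ 2 * lambda)
  (hcrit : 2 * p * alpha = n%:R + 2)
  (hu : Yspace p alpha u) (hv : Yspace q beta v)
  (hequ : \forall z \ae lebesgue_spacetime n,
     0 <= frac_heat p alpha u z <= v z `^ lambda)
  (heqv : \forall z \ae lebesgue_spacetime n,
     0 <= frac_heat q beta v z <= u z `^ sigma)
  (huv0 : \forall z \ae lebesgue_spacetime n,
     z.2 < 0 -> u z = 0 /\ v z = 0) :
  (1 <= lambda * sigma ->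
     \forall z \ae lebesgue_spacetime n, u z = 0 /\ v z = 0) /\
  (lambda * sigma < 1 ->
     forall T : R, 0 < T ->
     (Linfty_norm u T <=
       (M2 lambda sigma alpha beta `^ (lambda / (1 - lambda * sigma))
         * T `^ (gamma2 lambda sigma alpha beta / sigma))%:E)%E /\
     (Linfty_norm v T <=
       (M1 lambda sigma alpha beta `^ (sigma / (1 - lambda * sigma))
         * T `^ (gamma1 lambda sigma alpha beta / lambda))%:E)%E).
Proof.
(* For p > 1 the admissible range excludes the critical order, so only p = 1 remains. *)
have p1 : p = 1.
  case: hpalpha => [[p1 /andP[_]]|[]//].
  rewrite ltr_pdivlMr ?mulr_gt0 ?(lt_trans ltr01 p1)// => h.
  by move: h; rewrite -hcrit mulrC ltxx.
have aE : alpha = (n%:R + 2) / 2.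
  by move: hcrit; rewrite p1 mulr1 => <-; rewrite mulrAC divff ?mul1r.
have [Xf uf] := frac_heatP hu; have [Xg vg] := frac_heatP hv.
set f := frac_heat p alpha u in hequ Xf uf.
set g := frac_heat q beta v in heqv Xg vg.
have mf : measurable_fun setT f by case: Xf.
have mg : measurable_fun setT g by case: Xg.
have aeS := @filterS _ _ (ae_filter_ringOfSetsType (lebesgue_spacetime n)).
have uneg : \forall z \ae lebesgue_spacetime n, z.2 < 0 -> u z = 0.
  by apply: (aeS _ _ _ _ huv0) => z h /h[].
have f0 : \forall z \ae lebesgue_spacetime n, 0 <= f z.
  by apply: (aeS _ _ _ _ hequ) => z /andP[].
have ubd T : exists K, \forall z \ae lebesgue_spacetime n, z.2 < T -> u z <= K.
  have Xf1 : Xspace 1 f by rewrite -p1.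
  have uf1 : \forall z \ae lebesgue_spacetime n, (u z)%:E = J ((n%:R + 2) / 2) f z.
    by rewrite -aE.
  by have [K _ uK] := heat_potential_critical_bounded T Xf1 uf1 f0; exists K.
split => ls.
  have u0T T := system_vanish hlambda hsigma halpha hbeta mf mg uf vg
    hequ heqv uneg ls (ubd T).
  have u0 : \forall z \ae lebesgue_spacetime n, u z = 0.
    (* Integer times suffice, so that only countably many null sets are united. *)
    have := ae_foralln (fun k : nat => u0T k%:R).
    apply: aeS => z uz; apply: (uz (Num.truncn `|z.2|).+1).
    by apply: le_lt_trans (ler_norm _) _; rewrite truncnS_gt.
  have v0 : \forall z \ae lebesgue_spacetime n, v z = 0.
    (* Since sigma > 0, u = 0 forces g = 0, and v is its potential. *)
    apply: (heat_potential_eq0 mg vg).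
    apply: (@filterS2 _ _ (ae_filter_ringOfSetsType _) _ _ _ _ heqv u0) => z gz uz.
    by apply/eqP; rewrite eq_le andbC; move: gz; rewrite uz powR0 ?gt_eqF.
  by apply: (@filterS2 _ _ (ae_filter_ringOfSetsType _) _ _ _ _ u0 v0).
move=> T T0; have bound (e : R) (e0 : 0 < e) := system_bound hlambda hsigma
  halpha hbeta mf mg uf vg hequ heqv uneg ls e0 (ubd T).
split; apply: Linfty_norm_le; rewrite ?powR_ge0//.
- by rewrite divr_gt0// divr_gt0 ?subr_gt0// mulr_gt0// addr_gt0// mulr_gt0.
- by move=> e e0; have [] := bound e e0.
- by rewrite divr_gt0// divr_gt0 ?subr_gt0// mulr_gt0// addr_gt0// mulr_gt0.
- by move=> e e0; have [] := bound e e0.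
Qed.
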